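(* There exists a locally convex space $E$ such that: (i) $E$ is a Baire space; (ii) $E$ is feral, and hence $E$ is quasi-complete and has the property $(K)$; (iii) $E$ is not $\kappa$-Fréchet--Urysohn; (iv) the completion $\widehat{E}$ of $E$ is a $\kappa$-Fréchet--Urysohn space.
   Context: A topological vector space (tvs) is Baire if the intersection of any sequence of open dense subsets is dense. A tvs $E$ is feral if every bounded subset of $E$ is finite-dimensional (i.e. contained in a finite-dimensional linear subspace). A tvs $E$ is quasi-complete if any closed bounded subset of $E$ is complete. A sequence $(x_n)_n$ converging to $0$ in $E$ (a null sequence) is a $K$-sequence if every subsequence of $(x_n)_n$ contains a subsequence $(y_n)_n$ such that the series $\sum_n y_n$ converges in $E$; $E$ has the property $(K)$ if every null sequence in $E$ is a $K$-sequence. A Tychonoff space $X$ is $\kappa$-Fréchet--Urysohn if for any open set $U\subseteq X$ and each $x\in\overline{U}$ there exists a sequence in $U$ converging to $x$. *)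

(* Defs.v *)
From HB Require Import structures.
From mathcomp Require Import all_boot all_order all_algebra.
From mathcomp Require Import all_classical all_reals all_analysis.

Set Implicit Arguments.
Unset Strict Implicit.
Unset Printing Implicit Defensive.

Import Order.TTheory GRing.Theory Num.Theory.
Import numFieldNormedType.Exports.

Local Open Scope classical_set_scope.
Local Open Scope ring_scope.

Definition baire_space (T : topologicalType) : Prop :=
  forall F : (set T)^nat,
    (forall n, open (F n) /\ dense (F n)) -> dense (\bigcap_n F n).

(* Tychonoff is a standing assumption on the spaces to which this is applied,
   not part of the property, so that its negation stays meaningful. *)
Definition kappa_frechet_urysohn (T : topologicalType) : Prop :=
  forall (U : set T) (x : T), open U -> closure U x ->
    exists2 u : T^nat, (forall n, U (u n)) & u @ \oo --> x.

Section tvs_notions.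
Context {R : realType} {E : topologicalLmodType R}.
Implicit Types (A B : set E) (u : E^nat).

Definition tvs_bounded B : Prop :=
  forall U : set E, nbhs (0 : E) U ->
    \forall r \near +oo%R, B `<=` [set (r : R) *: x | x in U].

Definition finite_dimensional_set B : Prop :=
  exists (n : nat) (v : 'I_n -> E),
    B `<=` [set x | exists c : 'I_n -> R, x = \sum_(i < n) c i *: v i].

(* The uniformity carried by a [tvsType] induces the topology but is not
   required to be translation invariant, so the library's [cauchy] need not
   be the Cauchy property of the topological vector space. *)
Definition tvs_cauchy (F : set_system E) : Prop :=
  (fun xy : E * E => xy.1 - xy.2) @ (F, F) --> (0 : E).

Definition tvs_complete A : Prop :=
  forall F : set_system E, ProperFilter F -> F A -> tvs_cauchy F ->
    exists2 x, A x & F --> x.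

Definition K_sequence u : Prop :=
  forall f : nat -> nat, {homo f : m n / (m < n)%N} ->
    exists2 g : nat -> nat, {homo g : m n / (m < n)%N} &
      exists s : E, series (u \o f \o g) @ \oo --> s.

End tvs_notions.

Section tvs_properties.
Context {R : realType}.
Variable E : topologicalLmodType R.

Definition feral : Prop :=
  forall B : set E, tvs_bounded B -> finite_dimensional_set B.

Definition quasi_complete : Prop :=
  forall B : set E, closed B -> tvs_bounded B -> tvs_complete B.

Definition property_K : Prop :=
  forall u : E^nat, u @ \oo --> (0 : E) -> K_sequence u.

End tvs_properties.

(* [i : E -> F] exhibits [F] as the (Hausdorff) completion of [E]. *)
Definition is_completion {R : realType} {E F : topologicalLmodType R}
    (i : {linear E -> F}) : Prop :=
  [/\ hausdorff_space F,
      tvs_complete [set: F],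
      injective i,
      forall A : set E, open A <-> (exists2 B : set F, open B & i @^-1` B = A) &
      dense (range i)].

(* Main.v *)
Require Import Defs.
From HB Require Import structures.
From mathcomp Require Import all_boot all_order all_algebra.
From mathcomp Require Import all_classical all_reals all_analysis.
From mathcomp Require Import ring.

Set Implicit Arguments.
Unset Strict Implicit.
Unset Printing Implicit Defensive.

Import Order.TTheory GRing.Theory Num.Theory.
Import numFieldNormedType.Exports.

Local Open Scope classical_set_scope.
Local Open Scope ring_scope.

(** The space is spanned by vectors e_s indexed by well-founded, countably
branching trees, and its topology is the weak one for functionals phi_t indexed
by the same trees.  A tree carries a sequence of children, each labelled by a
real number, and phi_t (e_s) is the label of whichever of s and t is a child of
the other (0 if there is none).  No two trees are children of each other, so
labels never conflict, and a tree with given children and labels always exists.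
Hence, for any countable set of trees and any real values on it, one tree t
has these values as phi_t (e_s) for all s in the set, and one vector of the
space has these values as its images under the phi_s ([pairing_prescribe] and
[probe_prescribe]).  Everything follows from these two facts.

- Feral: if the vectors of B involve infinitely many basis vectors, a gliding
  hump chooses values on countably many trees that make a functional take the
  value n on the n-th of a sequence of vectors of B; some phi_t agrees with it
  on them, so B is unbounded.  Thus a bounded set lives on finitely many basis
  vectors, where the phi_t separate the coordinates.  Quasi-completeness and
  property (K) then reduce to coordinatewise convergence in a
  finite-dimensional space, resp. to a comparison with a geometric series.

- Baire: nested boxes as in the usual proof constrain only countably many
  functionals, and some vector of the space realises the limit values.

- Not kappa-Frechet-Urysohn: fix distinct trees t_0, t_1, ... and put
  y_i = phi_(t_i).  With tau = 1/(k+1), consider the open set of vectors with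
  |y_0| > tau and |y_(i+1)| < tau |y_i| for i < k.  The origin is in the
  closure of the union over k of these sets.  A null sequence in the union
  would be finite-dimensional, so that some fixed nonzero combination
  c_0 y_0 + ... + c_d y_d vanishes along it; but the ratios y_(i+1) / y_i tend
  to 0 along it, so the first term with a nonzero coefficient dominates all
  later ones.

- The completion is the full power of the real line over the set of trees, which
  is kappa-Frechet-Urysohn by an exhaustion argument on finite sets of
  coordinates. *)

(** * Weak topologies *)

(** The forms are a parameter of this copy of V, so that one vector space can
carry several weak topologies. *)
Definition weak (R : realType) (T : eqType) (V : lmodType R)
  (f : T -> {scalar V}) : Type := V.

HB.instance Definition _ (R : realType) (T : eqType) (V : lmodType R)
  (f : T -> {scalar V}) := GRing.Lmodule.on (weak f).

Section weak_topology.
Context (R : realType) (T : eqType) (V : lmodType R) (f : T -> {scalar V}).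

Let formZ t a (x : V) : f t (a *: x) = a * f t x.
Proof. exact: linearZ. Qed.

Definition box (S : seq T) (e : R) (x : weak f) : set (weak f) :=
  [set y | forall t, t \in S -> `|f t y - f t x| < e].

Definition weak_nbhs (x : weak f) : set_system (weak f) :=
  [set A | exists S e, 0 < e /\ box S e x `<=` A].

HB.instance Definition _ := hasNbhs.Build (weak f) weak_nbhs.

Lemma box_center S e (x : weak f) : 0 < e -> box S e x x.
Proof. by move=> e0 t tS; rewrite subrr normr0. Qed.

Lemma box_meet S S' e e' (x : weak f) :
  box (S ++ S') (Num.min e e') x `<=` box S e x `&` box S' e' x.
Proof.
by move=> y yB; split=> t tS;
  have := yB t; rewrite mem_cat tS ?orbT => /(_ isT); rewrite lt_min => /andP[].
Qed.

(** The finitely many gaps between e and the distances |f t y - f t x| have a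
positive minimum, which serves as radius around y. *)
Lemma box_around S e (x y : weak f) : box S e x y ->
  exists2 d, 0 < d & box S d y `<=` box S e x.
Proof.
elim: S => [|t S IH] xy; first by exists 1 => // z _ t.
have [|d d0 dS] := IH; first by move=> s sS; apply: xy; rewrite in_cons sS orbT.
have xyt : `|f t y - f t x| < e by apply: xy; rewrite mem_head.
exists (Num.min d (e - `|f t y - f t x|)); first by rewrite lt_min d0 subr_gt0.
move=> z yz s; rewrite in_cons => /predU1P[->|sS]; last first.
  apply: dS => // u uS; have := yz u; rewrite in_cons uS orbT => /(_ isT).
  by rewrite lt_min => /andP[].
have := yz t; rewrite mem_head => /(_ isT); rewrite lt_min => /andP[_].
rewrite ltrBrDr; apply: le_lt_trans.
by rewrite (le_trans _ (ler_normD _ _))// addrA subrK.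
Qed.

Fact weak_nbhs_filter (x : weak f) : ProperFilter (nbhs x).
Proof.
apply: Build_ProperFilter_ex.
  by move=> A [S [e [e0 eA]]]; exists x; apply: eA; exact: box_center.
split.
- by exists [::], 1.
- move=> A B [S [e [e0 eA]]] [S' [e' [e'0 e'B]]].
  exists (S ++ S'), (Num.min e e'); split; first by rewrite lt_min e0.
  by move=> y /box_meet[/eA ? /e'B].
- move=> A B AB [S [e [e0 eA]]]; exists S, e; split=> //.
  exact: subset_trans AB.
Qed.

Fact weak_nbhs_singleton (x : weak f) (A : set (weak f)) : nbhs x A -> A x.
Proof. by move=> [S [e [e0 eA]]]; apply: eA; exact: box_center. Qed.

Fact weak_nbhs_nbhs (x : weak f) (A : set (weak f)) :
  nbhs x A -> nbhs x (nbhs^~ A).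
Proof.
move=> [S [e [e0 eA]]]; exists S, e; split=> // y /box_around[d d0 dA].
by exists S, d; split=> //; exact: subset_trans eA.
Qed.

HB.instance Definition _ := Nbhs_isNbhsTopological.Build (weak f)
  weak_nbhs_filter weak_nbhs_singleton weak_nbhs_nbhs.

Lemma nbhs_weakP (x : weak f) (A : set (weak f)) :
  nbhs x A <-> exists S e, 0 < e /\ box S e x `<=` A.
Proof. by []. Qed.

Lemma nbhs_box S e (x : weak f) : 0 < e -> nbhs x (box S e x).
Proof. by move=> e0; exists S, e; split. Qed.

Lemma open_box S e (x : weak f) : open (box S e x).
Proof.
rewrite openE => y /box_around[d d0 dA].
by rewrite /interior; apply/nbhs_weakP; exists S, d.
Qed.

Fact weak_add_continuous :
  continuous (fun x : weak f * weak f => x.1 + x.2).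
Proof.
move=> [x y] A /nbhs_weakP[S [e [e0 eA]]] /=.
exists (box S (e / 2) x, box S (e / 2) y).
  by split; apply: nbhs_box; rewrite divr_gt0.
move=> [x' y'] [/= xx' yy']; apply: eA => t tS; rewrite !linearD /=.
rewrite addrACA (le_lt_trans (ler_normD _ _))// (splitr e).
by rewrite ltrD ?xx' ?yy'.
Qed.

Fact weak_scale_continuous :
  continuous (fun z : R^o * weak f => z.1 *: z.2).
Proof.
move=> [k x] A /nbhs_weakP[S [e [e0 eA]]] /=.
apply: (filterS eA) => {A eA}; elim: S => [|t S IH].
  by apply: filterS (@filterT _ (nbhs (k, x)) _).
have ct : \forall z \near (k, x), `|f t (z.1 *: z.2) - f t (k *: x)| < e.
  pose M := `|f t x| + 1; have M0 : 0 < M by rewrite ltr_wpDl.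
  pose K := `|k| + 1; have K0 : 0 < K by rewrite ltr_wpDl.
  pose d := Num.min 1 (e / 2 / M).
  have d0 : 0 < d by rewrite lt_min ltr01 !divr_gt0.
  exists (ball (k : R^o) d, box [:: t] (Num.min 1 (e / 2 / K)) x).
    split; first exact: nbhsx_ballx.
    by apply: nbhs_box; rewrite lt_min ltr01 !divr_gt0.
  move=> [l y] [/= kl xy]; have := xy t; rewrite mem_head => /(_ isT).
  rewrite lt_min => /andP[xy1 xye]; move: kl; rewrite /ball /= lt_min distrC.
  move=> /andP[kl1 kle]; rewrite !formZ.
  have -> : l * f t y - k * f t x = l * (f t y - f t x) + (l - k) * f t x.
    by ring.
  rewrite (le_lt_trans (ler_normD _ _))// (splitr e) !normrM ltrD//.
    have lK : `|l| <= K.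
      rewrite -(subrK k l) (le_trans (ler_normD _ _))// addrC lerD2l.
      exact: ltW.
    rewrite (le_lt_trans (ler_wpM2r _ lK))// mulrC -ltr_pdivlMr//.
  have xM : `|f t x| <= M by rewrite lerDl.
  by rewrite (le_lt_trans (ler_wpM2l _ xM))// -ltr_pdivlMr.
apply: filterS (filterI ct IH) => z [zt zS] s.
by rewrite in_cons => /predU1P[->//|/zS].
Qed.

Fact weak_locally_convex :
  exists2 B : set_system (weak f),
    (forall b, b \in B -> convex_set b) & basis B.
Proof.
exists [set B | exists S e x, B = box S e x].
  move=> _ /set_mem[S [e [x ->]]]; apply/convex_setW => y z yB zB l l0 l1.
  move: yB zB; rewrite !inE => yB zB t tS.
  have -> : f t (conv l y z) = l%:num * f t y + (1 - l%:num) * f t z.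
    by rewrite linearD !formZ.
  have -> : l%:num * f t y + (1 - l%:num) * f t z - f t x =
     l%:num * (f t y - f t x) + (1 - l%:num) * (f t z - f t x) by ring.
  rewrite (le_lt_trans (ler_normD _ _))// !normrM.
  rewrite (@ger0_norm _ l%:num)// (@ger0_norm _ (1 - l%:num)) ?subr_ge0//.
  have -> : e = l%:num * e + (1 - l%:num) * e by ring.
  by rewrite ltrD// ltr_pM2l ?subr_gt0// ?yB ?zB.
split; first by move=> _ [S [e [x ->]]]; exact: open_box.
move=> x A /nbhs_weakP[S [e [e0 eA]]]; exists (box S e x) => //.
by split; [exists S, e, x|exact: box_center].
Qed.

(* This first instance contributes the uniformity; the continuity of the
   operations and local convexity are attached to it by the next three. *)
HB.instance Definition _ := PreTopologicalLmod_isTvs.Build R (weak f)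
  weak_add_continuous weak_scale_continuous weak_locally_convex.
HB.instance Definition _ :=
  PreTopologicalNmodule_isTopologicalNmodule.Build (weak f) weak_add_continuous.
HB.instance Definition _ :=
  TopologicalNmodule_isTopologicalLmodule.Build R (weak f)
    weak_scale_continuous.
HB.instance Definition _ :=
  Uniform_isTvs.Build R (weak f) weak_locally_convex.

Lemma form_continuous t : continuous (f t : weak f -> R).
Proof.
move=> x A /nbhs_ballP[e /= e0 eA].
apply: filterS (nbhs_box [:: t] x e0) => y /(_ t).
by rewrite mem_head distrC => /(_ isT)/eA.
Qed.

Lemma cvg_weakP (F : set_system (weak f)) (x : weak f) : Filter F ->
  F --> x <-> forall t, f t y @[y --> F] --> f t x.
Proof.
move=> FF; split=> [Fx t|Fx].
  by apply: cvg_comp Fx _; exact: form_continuous.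
move=> A /nbhs_weakP[S [e [e0 eA]]]; apply: (filterS eA) => {A eA}.
elim: S => [|t S IH]; first by apply: filterS filterT.
have /cvgrPdist_lt/(_ e e0) Ft := Fx t.
apply: filterS (filterI Ft IH) => y [yt yS] s.
by rewrite in_cons => /predU1P[->|/yS]; rewrite // distrC.
Qed.

Lemma weak_hausdorff : (forall x : V, (forall t, f t x = 0) -> x = 0) ->
  hausdorff_space (weak f).
Proof.
move=> f0 x y xy; apply/eqP; rewrite -subr_eq0; apply/eqP/f0 => t.
rewrite linearB /=; apply/eqP; rewrite subr_eq0; apply/eqP.
apply: contrapT => /eqP ne.
have e0 : 0 < `|f t x - f t y| / 2 by rewrite divr_gt0// normr_gt0 subr_eq0.
have [z []] := xy _ _ (nbhs_box [:: t] x e0) (nbhs_box [:: t] y e0).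
move=> /(_ t); rewrite mem_head => /(_ isT) xz.
move=> /(_ t); rewrite mem_head => /(_ isT) yz.
have := ltrD xz yz; rewrite -splitr distrC ltNge => /negP; apply.
by rewrite (le_trans _ (ler_normD _ _))// addrA subrK.
Qed.

(** Each form is small on a box around 0, so it maps Cauchy filters to Cauchy
filters of reals, which converge. *)
Lemma tvs_cauchy_form (F : set_system (weak f)) t : ProperFilter F ->
  tvs_cauchy F -> cvg (f t y @[y --> F]).
Proof.
move=> FF FC; apply: cauchy_cvg; apply/cauchy_ballP => e e0 /=.
have [[A B] [/= FA FB] AB] := FC _ (nbhs_box [:: t] 0 e0).
exists (f t @` A, f t @` B).
  by split; [apply: filterS FA|apply: filterS FB] => x xP; exists x.
move=> [_ _] [/= [x Ax <-] [y By <-]].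
have := AB (x, y) (conj Ax By) t; rewrite mem_head => /(_ isT).
by rewrite linear0 subr0 linearB.
Qed.

Lemma weak_complete : (forall a : T -> R, exists x, forall t, f t x = a t) ->
  tvs_complete [set: weak f].
Proof.
move=> fs F FF _ FC.
have [x xE] := fs (fun t => lim (f t y @[y --> F])).
exists x => //; apply/cvg_weakP => t; rewrite xE.
exact: tvs_cauchy_form.
Qed.

End weak_topology.

(** * Finitely supported functions *)

Section finitely_supported.
Context (R : realType) (I : choiceType).

(** The codomain is R^o, the regular module, since pointwise operations are
those of functions into a module. *)
Definition finitely_supported : {pred I -> R^o} :=
  fun x => `[< exists S : seq I, forall s, s \notin S -> x s = 0 >].

Fact finitely_supported_submod : submod_closed finitely_supported.
Proof.
split; first by apply/asboolP; exists [::].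
move=> a x y /asboolP[S xS] /asboolP[S' yS']; apply/asboolP.
exists (S ++ S') => s; rewrite mem_cat => /norP[sS sS'].
by rewrite /= !fctE xS// yS'// scaler0 addr0.
Qed.

HB.instance Definition _ := GRing.isSubmodClosed.Build R (I -> R^o)
  finitely_supported finitely_supported_submod.

Record finsupp := Finsupp {
  coef :> I -> R^o ; _ : coef \in finitely_supported }.

HB.instance Definition _ := [isSub for coef].
HB.instance Definition _ := [Choice of finsupp by <:].
HB.instance Definition _ := [SubChoice_isSubLmodule of finsupp by <:].

Definition supported_in (S : seq I) (x : finsupp) :=
  forall s, s \notin S -> x s = 0.

Lemma finsuppP (x : finsupp) : exists S, supported_in S x.
Proof. by have /asboolP[S xS] := valP x; exists S. Qed.

Lemma finsupp_eqP (x y : finsupp) : (forall s, x s = y s) -> x = y.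
Proof. by move=> xy; apply/val_inj/funext. Qed.

Lemma mk_finsupp (S : seq I) (a : I -> R) :
  exists2 x : finsupp, supported_in S x & forall s, s \in S -> x s = a s.
Proof.
have aP : (fun s => if s \in S then a s else 0) \in finitely_supported.
  by apply/asboolP; exists S => s /negbTE ->.
exists (Finsupp aP); first by move=> s /= /negbTE ->.
by move=> s /= ->.
Qed.

(** The linear form on the free vector space over I that extends
the assignment a of values to the basis vectors. *)
Definition lincomb (a : I -> R) (x : finsupp) : R :=
  \sum_(s \in [set: I]) x s * a s.

Lemma lincombE S a x : supported_in S x ->
  lincomb a x = \sum_(s <- undup S) x s * a s.
Proof.
move=> xS; rewrite /lincomb -(fsbig_widen [set` undup S] setT) => //.
  by rewrite -fsbig_seq ?undup_uniq.
move=> s [_ /= /negP]; rewrite mem_undup => /xS ->.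
by rewrite mul0r.
Qed.

Fact lincomb_is_scalar a : scalar (lincomb a).
Proof.
move=> k x y; have [[S xS] [S' yS']] := (finsuppP x, finsuppP y).
have w (z : finsupp) S1 S2 : supported_in S1 z -> supported_in (S1 ++ S2) z.
  by move=> zS s; rewrite mem_cat => /norP[/zS].
have w' (z : finsupp) S1 S2 : supported_in S2 z -> supported_in (S1 ++ S2) z.
  by move=> zS s; rewrite mem_cat => /norP[_ /zS].
have xU := w _ _ S' xS; have yU := w' _ S _ yS'.
have zU : supported_in (S ++ S') (k *: x + y).
  by move=> s sU; rewrite /= !fctE xU// yU// scaler0 addr0.
rewrite (lincombE _ xU) (lincombE _ yU) (lincombE _ zU).
rewrite mulr_sumr -big_split; apply: eq_bigr => s _ /=.
by rewrite !fctE /= /GRing.scale /= mulrDl mulrA.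
Qed.

HB.instance Definition _ a := GRing.isLinear.Build R finsupp R *%R (lincomb a)
  (lincomb_is_scalar a).

End finitely_supported.

(** * Trees and their pairing *)

Section tree.
Context (R : realType).

(** [node c a] has the c n as children and labels c n by a n; repeated children
are allowed, so that any countable family, finite or not, can be listed. *)
Inductive tree := leaf | node of (nat -> tree) & (nat -> R).

HB.instance Definition _ := gen_eqMixin tree.
HB.instance Definition _ := gen_choiceMixin tree.

Definition child (s t : tree) : Prop :=
  if t is node c _ then exists n, c n = s else False.

(** If s occurs several times among the children of t, one occurrence is chosen.
*)
Definition label (s t : tree) : R :=
  if t is node c a then a (xget 0 [set n | c n = s])%N else 0.

Definition pairing (s t : tree) : R :=
  if pselect (child s t) then label s t
  else if pselect (child t s) then label t s else 0.

(** A 2-cycle of children would descend forever in a well-founded tree. *)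
Lemma child_asym t s : child s t -> ~ child t s.
Proof.
elim: t s => [s []|c IH a _ [n <-] tc].
by have := IH n _ tc; apply; exists n.
Qed.

Lemma pairingC s t : pairing s t = pairing t s.
Proof.
rewrite /pairing; case: pselect => st; case: pselect => ts //.
by have := child_asym st ts.
Qed.

Lemma pairing_node (c : nat -> tree) (g : tree -> R) n :
  pairing (c n) (node c (g \o c)) = g (c n).
Proof.
rewrite /pairing; case: pselect => [cnt|[]]; last by exists n.
rewrite /label /=; congr g.
by apply: (xgetPex 0%N (P := [set k | c k = c n])); exists n.
Qed.

(** The union of the finite lists S_ N is listed by a single sequence through a
code for pairs; the tree with these children and labels g has the required
pairings. *)
Lemma pairing_prescribe (S_ : nat -> seq tree) (g : tree -> R) :
  exists t, forall N s, s \in S_ N -> pairing s t = g s.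
Proof.
pose c k := if unpickle k is Some p then nth leaf (S_ p.1) p.2 else leaf.
exists (node c (g \o c)) => N s sN.
have <- : c (pickle (N, index s (S_ N))) = s by rewrite /c pickleK nth_index.
exact: pairing_node.
Qed.

(** An infinite supply of distinct trees: the real labels tell them apart. *)
Definition trunk (n : nat) : tree := node (fun=> leaf) (fun=> n%:R).

Lemma trunk_inj : injective trunk.
Proof.
move=> m n [] /(congr1 (@^~ 0%N)) /eqP.
by rewrite eqr_nat => /eqP.
Qed.

End tree.

(** * The space and its bounded sets *)

Section bounded_sets.
Context (R : realType).
Local Notation tree := (tree R).

(** The functional phi_t of the introduction, where e_s is the indicator function
of s. *)
Definition probe (t : tree) : {scalar finsupp R tree} :=
  lincomb (fun s => pairing s t).

Definition tree_space := weak probe.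

Local Notation E := tree_space.

Lemma probe_delta (s : tree) :
  exists x : E, forall t, probe t x = pairing s t.
Proof.
have [x xS xE] := mk_finsupp [:: s] (fun=> 1 : R).
exists x => t; rewrite /probe /= (lincombE _ xS) /= big_seq1.
by rewrite xE ?mem_head// mul1r.
Qed.

(** By symmetry of the pairing, a tree that is prescribed as a functional is
also a basis vector with prescribed images. *)
Lemma probe_prescribe (S_ : nat -> seq tree) (a : tree -> R) :
  exists x : E, forall N t, t \in S_ N -> probe t x = a t.
Proof.
have [s sP] := pairing_prescribe S_ a; have [x xE] := probe_delta s.
by exists x => N t tN; rewrite xE pairingC (sP N).
Qed.

(** On a finite set of basis vectors, prescribing the values of a functional to
be the indicator of s gives the coordinate at s. *)
Lemma probe_coef (S : seq tree) : exists t_ : tree -> tree,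
  forall s (x : E), s \in S -> supported_in S x -> probe (t_ s) x = x s.
Proof.
have P s : exists t, forall x : E, s \in S -> supported_in S x ->
    probe t x = x s.
  have [t tP] := pairing_prescribe (fun=> S) (fun u => (u == s)%:R).
  exists t => x sS xS; rewrite /probe /= (lincombE _ xS).
  rewrite (bigD1_seq s) ?mem_undup ?undup_uniq//= (tP 0%N)// eqxx mulr1.
  rewrite big_seq_cond big1 ?addr0// => u.
  rewrite mem_undup => /andP[uS /negbTE us].
  by rewrite (tP 0%N)// us mulr0.
by have [t_ tP] := choice P; exists t_ => s x; exact: tP.
Qed.

Lemma probe_inj (x : E) : (forall t, probe t x = 0) -> x = 0.
Proof.
move=> x0; have [S xS] := finsuppP x; have [t_ tP] := probe_coef S.
apply: finsupp_eqP => s; have [sS|sS] := boolP (s \in S).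
  by rewrite -(tP s)// x0.
by rewrite xS.
Qed.

Definition pointwise_bounded (B : set E) :=
  forall t, exists M, forall x, B x -> `|probe t x| <= M.

(** One step of the gliding hump. The vector x has a nonzero coefficient at some
s0 outside S, where the value is still free; adjusting it gives x any image r.
The list S' records where values are now fixed: on S and on the support of x. *)
Lemma extend_prescription (g : tree -> R) (S : seq tree) (x : E) (r : R) :
  ~ supported_in S x -> exists S' g',
    [/\ {subset S <= S'}, {in S, g' =1 g}, supported_in S' x &
        lincomb g' x = r].
Proof.
move=> /existsNP[s0 /not_implyP[s0S /eqP xs0]].
have [S1 xS1] := finsuppP x; exists (S ++ S1).
pose g0 s := if s \in S then g s else 0.
pose v := (r - lincomb g0 x) / x s0.
exists (fun s => g0 s + (s == s0)%:R * v).
have xS : supported_in (S ++ S1) x.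
  by move=> s; rewrite mem_cat => /norP[_ /xS1].
have s0m : s0 \in S ++ S1.
  by apply: contraR xs0 => /xS ->.
split=> //.
- by move=> s sS; rewrite mem_cat sS.
- move=> s sS; rewrite /g0 sS; case: eqP => [ss|]; last by rewrite mul0r addr0.
  by move: sS; rewrite ss (negbTE s0S).
rewrite (lincombE _ xS); under eq_bigr do rewrite mulrDr.
rewrite big_split -(lincombE g0 xS) /=.
rewrite (bigD1_seq s0) ?mem_undup ?undup_uniq//= eqxx mul1r.
rewrite big1 ?addr0 => [|s /negbTE ->]; last by rewrite mul0r mulr0.
by rewrite /v mulrC divfK// addrC subrK.
Qed.

(** Iterating [extend_prescription] yields compatible prescriptions on growing
finite lists; a single tree realises their union and has unbounded values on B.
*)
Lemma pointwise_bounded_supported (B : set E) : pointwise_bounded B ->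
  exists S, forall x, B x -> supported_in S x.
Proof.
move=> Bb; apply: contrapT => /forallNP nS.
have {}nS S : exists2 x, B x & ~ supported_in S x.
  by have /existsNP[x /not_implyP[]] := nS S; exists x.
pose step (p q : seq tree * (tree -> R) * nat) :=
  [/\ {subset p.1.1 <= q.1.1}, {in p.1.1, q.1.2 =1 p.1.2}, q.2 = p.2.+1 &
      exists x, [/\ B x, supported_in q.1.1 x & lincomb q.1.2 x = p.2%:R]].
have next p : {q | step p q}.
  apply: cid; case: p => [[S g] n]; have [x Bx xS] := nS S.
  have [S' [g' [SS' gg' xS' xE]]] := extend_prescription g n%:R xS.
  exists (S', g', n.+1); rewrite /step /=; split=> //; exists x; split=> //.
have [h [h0 hS]] := dependent_choice next ([::], fun=> 0, 0%N).
have hn n : (h n).2 = n.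
  by elim: n => [|n IH]; [rewrite h0|have [_ _ -> _] := hS n; rewrite IH].
have mono m n : (m <= n)%N -> {subset (h m).1.1 <= (h n).1.1} /\
    {in (h m).1.1, (h n).1.2 =1 (h m).1.2}.
  elim: n => [|n IH]; first by rewrite leqn0 => /eqP ->; split.
  rewrite leq_eqVlt => /predU1P[->|/IH[Smn gmn]]; first by split.
  have [SS gS _ _] := hS n.
  by split=> [s /Smn /SS//|s sm]; rewrite gS ?gmn// Smn.
(* The union of the successive prescriptions. *)
pose G s := xget 0 [set r | exists n, s \in (h n).1.1 /\ r = (h n).1.2 s].
have GE n s : s \in (h n).1.1 -> G s = (h n).1.2 s.
  move=> sn; have [|m [sm]] := xgetPex 0
    (P := [set r | exists n, s \in (h n).1.1 /\ r = (h n).1.2 s]).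
    by exists ((h n).1.2 s), n.
  rewrite -/(G s) => ->.
  by have [/mono[_ ->]|/ltnW/mono[_ ->]] := leqP m n.
have [t tP] := pairing_prescribe (fun n => (h n).1.1) G.
have [M MP] := Bb t.
have [_ _ _ [x [Bx xS xE]]] := hS (Num.truncn M).+1.
have : probe t x = (Num.truncn M).+1%:R.
  rewrite -[X in X%:R]hn -xE /probe /= !(lincombE _ xS).
  apply: eq_big_seq => s; rewrite mem_undup => sS.
  by rewrite (tP _ _ sS) (GE _ _ sS).
move=> xt; have := MP x Bx; rewrite xt ger0_norm// leNgt.
by rewrite truncnS_gt.
Qed.

Lemma tvs_bounded_pointwise (B : set E) : tvs_bounded B -> pointwise_bounded B.
Proof.
move=> Bb t; have [M [Mr MP]] := Bb _ (nbhs_box [:: t] (0 : E) ltr01).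
pose r := Num.max M 0 + 1; exists r => x Bx.
have Mr' : M < r by rewrite ltr_pwDr// le_max lexx.
have r0 : 0 < r by rewrite ltr_pwDr// le_max lexx orbT.
have [y /(_ t) + <-] := MP r Mr' x Bx.
rewrite mem_head linear0 subr0 => /(_ isT) yt.
by rewrite linearZ normrM gtr0_norm// ger_pMr// ltW.
Qed.

Lemma bounded_supported (B : set E) : tvs_bounded B ->
  exists S, forall x, B x -> supported_in S x.
Proof. by move=> /tvs_bounded_pointwise/pointwise_bounded_supported. Qed.

Lemma coef_sum n (v : 'I_n -> E) s : (\sum_i v i) s = \sum_i v i s.
Proof. by elim/big_ind2: _ => // x a y b <- <-. Qed.

Lemma tree_space_feral : feral E.
Proof.
move=> B /bounded_supported[S BS].
have v_ s : {v : E | supported_in [:: s] v /\ v s = 1}.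
  apply: cid; have [v vS vE] := mk_finsupp [:: s] (fun=> 1 : R).
  by exists v; split=> //; rewrite vE// mem_head.
pose U := undup S.
exists (size U), (fun i => sval (v_ (nth (leaf R) U i))) => x Bx.
exists (fun i => x (nth (leaf R) U i)).
apply: finsupp_eqP => s; rewrite coef_sum.
rewrite -(big_mkord xpredT (fun i => (x (nth (leaf R) U i) *:
   sval (v_ (nth (leaf R) U i)) : E) s)).
rewrite -(big_nth _ xpredT (fun u => (x u *: sval (v_ u) : E) s)).
have vne u : u != s -> (x u *: sval (v_ u) : E) s = 0.
  move=> us; have [vS _] := svalP (v_ u).
  by rewrite /= fctE vS ?scaler0// mem_seq1 eq_sym.
have [sS|sS] := boolP (s \in S).
  rewrite (bigD1_seq s) ?mem_undup ?undup_uniq//= big1 ?addr0//.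
  have [_ vs] := svalP (v_ s).
  by rewrite fctE vs /GRing.scale /= mulr1.
rewrite BS// big_seq big1// => u; rewrite mem_undup => uS; apply: vne.
by apply: contraNneq sS => <-.
Qed.

End bounded_sets.

(** * Completeness and category *)

Section completeness.
Context (R : realType).
Local Notation tree := (tree R).
Local Notation E := (tree_space R).

Lemma tree_space_hausdorff : hausdorff_space E.
Proof. by apply: weak_hausdorff; exact: probe_inj. Qed.

(** Among vectors supported in a fixed finite list, every functional of the
family is a finite combination of coefficients. *)
Lemma cvg_coef (F : set_system E) (S : seq tree) (x : E) : Filter F ->
  F [set y | supported_in S y] -> supported_in S x ->
  (forall s, s \in S -> (y : E) s @[y --> F] --> (x s : R)) -> F --> x.
Proof.
move=> FF FS xS Fx; apply/cvg_weakP => t.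
rewrite /probe /= (lincombE _ xS).
apply: (@cvg_trans _
    ((\sum_(s <- undup S) (y : E) s * pairing s t) @[y --> F])).
  apply: near_eq_cvg; apply: filterS FS => y yS /=.
  by rewrite (lincombE _ yS).
rewrite big_seq; under eq_fun do rewrite big_seq.
apply: (cvg_big (@add_continuous R^o)) => s; rewrite mem_undup => sS.
by apply: cvgM; [exact: Fx|exact: cvg_cst].
Qed.

(** The limits of the coefficients, which are functionals of the family on the
finite-dimensional set B, define the limit vector. *)
Lemma tree_space_quasi_complete : quasi_complete E.
Proof.
move=> B Bcl /bounded_supported[S BS] F FF FB FC.
have [t_ tP] := probe_coef S.
have [x xS xE] := mk_finsupp S (fun s => lim (probe (t_ s) y @[y --> F])).
have Fx : F --> (x : E).
  apply: (@cvg_coef _ S) => //; first by apply: filterS FB => y /BS.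
  move=> s sS; rewrite xE//.
  apply: cvg_trans (tvs_cauchy_form (t := t_ s) FF FC).
  apply: near_eq_cvg; apply: filterS FB => y By /=.
  by rewrite tP//; exact: BS.
exists x => //; apply: Bcl => A /Fx FA.
exact: filter_ex (filterI FB FA).
Qed.

(** A convergent sequence is pointwise bounded, hence finite-dimensional. *)
Lemma null_sequence_supported (u : E^nat) : u @ \oo --> (0 : E) ->
  exists S, forall n, supported_in S (u n).
Proof.
move=> u0; have [|S uS] := @pointwise_bounded_supported R (range u).
  move=> t; have /cvgP/cvg_seq_bounded[M [_ MP]] :
      probe t (u n) @[n --> \oo] --> probe t (0 : E).
    by move/cvg_weakP : u0; exact.
  exists (M + 1) => _ [n _ <-].
  by apply: (MP (M + 1)); rewrite ?ltrDl.
by exists S => n; apply: uS; exists n.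
Qed.

Lemma exists_increasing (N_ : nat -> nat) :
  exists2 g : nat -> nat,
    {homo g : m n / (m < n)%N} & forall n, (N_ n <= g n)%N.
Proof.
pose g := fix g n := if n is m.+1 then maxn (g m).+1 (N_ n) else N_ 0%N.
exists g; last by case=> [|n] //=; exact: leq_maxr.
by apply: homo_ltn => [|n]; [exact: ltn_trans|exact: leq_maxl].
Qed.

(** All coefficients tend to 0 on a common finite support, so a subsequence has
coefficients below 2^-n, and its series converges by comparison. *)
Lemma tree_space_property_K : property_K E.
Proof.
move=> u u0 f fhomo.
have [S uS] := null_sequence_supported u0.
have [t_ tP] := probe_coef S.
have N_ n : exists N, forall m, (N <= m)%N -> forall s, s \in S ->
    `|u m s| < (2 ^+ n)^-1.
  have e0 : 0 < (2 ^+ n)^-1 :> R by rewrite invr_gt0 exprn_gt0.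
  have [N _ NP] := u0 _ (nbhs_box (map t_ S) (0 : E) e0).
  exists N => m Nm s sS; have := NP m Nm (t_ s); rewrite map_f// => /(_ isT).
  by rewrite linear0 subr0 tP//; exact: uS.
have [N NP] := choice N_.
have [g ghomo gN] := exists_increasing N.
exists g => //.
have fge m : (m <= f m)%N.
  elim: m => // m IH; apply: leq_ltn_trans IH _; exact: fhomo.
have small n s : s \in S -> `|u (f (g n)) s| <= geometric 1 2^-1 n.
  move=> sS; rewrite /geometric /= mul1r exprVn ltW// NP//.
  exact: leq_trans (gN n) (fge _).
have cvgs s : s \in S -> cvg (series (fun n => u (f (g n)) s : R) @ \oo).
  move=> sS; apply: (@normed_cvg R R^o).
  apply: (series_le_cvg _ _ (fun n => small n s sS)) => // [n|].
    by rewrite /geometric /= mul1r exprn_ge0.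
  by apply: is_cvg_geometric_series; rewrite ger0_norm// invf_lt1// ltr1n.
have [z zS zE] := mk_finsupp S
  (fun s => lim (series (fun n => u (f (g n)) s : R) @ \oo)).
have serE n s : series (u \o f \o g) n s = series (fun n => u (f (g n)) s) n.
  rewrite /series /=; elim: n => [|n IH]; first by rewrite !big_geq.
  by rewrite !big_nat_recr//= -IH.
exists z; apply: (@cvg_coef _ S) => //.
  exists 0%N => // n _ s sS /=; rewrite serE /series /= big1// => k _.
  exact: uS.
move=> s sS; rewrite zE//; have := cvgs s sS.
by rewrite -(funext (serE^~ s : _ =1 series (fun n => u (f (g n)) s : R))).
Qed.

(** A decreasing sequence of closed boxes with radii tending to 0 constrains
only the functionals in the union of its finite lists. Their values at the
centres converge, and a vector with the limit values lies in every box. *)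
Lemma tree_space_baire : baire_space E.
Proof.
move=> G GP O [x0 Ox0] Oo.
have [S0 [e0 [e00 OS0]]] : nbhs x0 O by exact: open_nbhs_nbhs.
pose cbox (p : E * seq tree * R) : set E :=
  [set y | forall t, t \in p.1.2 -> `|probe t y - probe t p.1.1| <= p.2].
(* A stage is its index together with the centre, the list and the radius of a
   closed box. *)
pose X := {p : nat * (E * seq tree * R) | 0 < p.2.2}.
pose step (p q : X) := [/\ (sval q).1 = (sval p).1.+1,
  {subset (sval p).2.1.2 <= (sval q).2.1.2},
  cbox (sval q).2 `<=` G (sval p).1 `&` cbox (sval p).2 &
  (sval q).2.2 <= (2 ^+ (sval p).1)^-1].
have next p : {q | step p q}.
  apply: cid; case: p => [[n [[y S] r]] /= r0].
  have [Gno Gnd] := GP n.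
  have [|z [zb zG]] := Gnd (box S r y) _ (open_box (x := y)).
    by exists y; exact: box_center.
  have : nbhs z (G n `&` box S r y).
    by apply: open_nbhs_nbhs; split=> //; apply: openI => //; exact: open_box.
  move=> [S' [e [e_gt0 eG]]].
  pose r' := Num.min (e / 2) (2 ^+ n)^-1.
  have r'0 : 0 < r' by rewrite lt_min divr_gt0//= invr_gt0 exprn_gt0.
  exists (exist _ (n.+1, (z, S ++ S', r')) r'0); split => //=.
  - by move=> s sS; rewrite mem_cat sS.
  - move=> w /= wz; have [|? wy] := eG w.
      move=> t tS'; have := wz t; rewrite mem_cat tS' orbT => /(_ isT).
      rewrite /r' le_min => /andP[we _]; apply: le_lt_trans we _.
      by rewrite ltr_pdivrMr// ltr_pMr// ltr1n.
    by split=> // t /wy/ltW.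
  - by rewrite /r' ge_min lexx orbT.
have r00 : 0 < e0 / 2 by rewrite divr_gt0.
have [h [h0 hS]] := dependent_choice next (exist _ (0%N, (x0, S0, e0 / 2)) r00).
have hn n : (sval (h n)).1 = n.
  by elim: n => [|n IH]; [rewrite h0|have [-> _ _ _] := hS n; rewrite IH].
pose y n : E := (sval (h n)).2.1.1.
pose S_ n := (sval (h n)).2.1.2.
pose r n := (sval (h n)).2.2.
pose C n := cbox (sval (h n)).2.
have mono m n : (m <= n)%N -> C n `<=` C m /\ {subset S_ m <= S_ n}.
  elim: n => [|n IH]; first by rewrite leqn0 => /eqP ->; split.
  rewrite leq_eqVlt => /predU1P[->|/IH[Cnm Smn]]; first by split.
  have [_ SS CC _] := hS n.
  by split=> [w /CC[_ /Cnm]//|s /Smn /SS].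
have yC n : C n (y n).
  by move=> t _; rewrite subrr normr0 ltW// (svalP (h n)).
have ry m n t : (m <= n)%N -> t \in S_ m ->
    `|probe t (y n) - probe t (y m)| <= r m.
  by move=> mn tm; have [/(_ _ (yC n)) Cm _] := mono _ _ mn; exact: Cm.
have rle n : r n.+1 <= (2 ^+ n)^-1 by have [_ _ _] := hS n; rewrite hn.
have ycvg m t : t \in S_ m -> cvg (probe t (y n) @[n --> \oo]).
  move=> tm; apply: cauchy_cvg; apply/cauchy_exP => e e_gt0.
  have [k [mk ke]] : exists k, (m <= k)%N /\ r k.+1 < e.
    have /cvgrPdist_lt/(_ e e_gt0)[k _ kP] :
        (2^-1 : R) ^+ n @[n --> \oo] --> (0 : R).
      by apply: cvg_expr; rewrite ger0_norm// invf_lt1// ltr1n.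
    exists (maxn m k); split; first exact: leq_maxl.
    apply: le_lt_trans (rle _) _; have := kP (maxn m k) (leq_maxr _ _).
    by rewrite sub0r normrN ger0_norm ?exprn_ge0// exprVn.
  exists (probe t (y k.+1)); exists k.+1 => // n /= kn.
  rewrite /ball /= distrC; apply: le_lt_trans ke; apply: ry => //.
  by have [_] := mono _ _ (leqW mk); exact.
have [w wP] := probe_prescribe S_ (fun t => lim (probe t (y n) @[n --> \oo])).
have wC n : C n w.
  move=> t tn; rewrite (wP n)//.
  have cv : `|probe t (y k) - probe t (y n)| @[k --> \oo] -->
     `|lim (probe t (y n) @[n --> \oo]) - probe t (y n)|.
    by apply: cvg_norm; apply: cvgB; [exact: (ycvg n)|exact: cvg_cst].
  rewrite -(cvg_lim _ cv)//; apply: limr_le.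
    by apply/cvg_ex; eexists; exact: cv.
  by exists n => // k /= nk; exact: ry.
exists w; split.
  apply: OS0 => t tS; have := wC 0%N t; rewrite /C h0 /= => /(_ tS).
  by move=> /le_lt_trans; apply; rewrite ltr_pdivrMr// ltr_pMr// ltr1n.
by move=> n _; have [_ _ /(_ w (wC n.+1))[+ _] _] := hS n; rewrite hn.
Qed.

End completeness.

(** * Powers of the real line *)

Section cartesian_power.
Context (R : realType) (I : eqType).

Definition eval (t : I) (a : I -> R^o) : R := a t.

Fact eval_is_scalar t : scalar (eval t).
Proof. by []. Qed.

HB.instance Definition _ t := GRing.isLinear.Build R (I -> R^o) R *%R (eval t)
  (eval_is_scalar t).

Definition power := weak (fun t => eval t : {scalar (I -> R^o)}).

Lemma power_hausdorff : hausdorff_space power.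
Proof. by apply: weak_hausdorff => x x0; apply/funext => t; exact: x0. Qed.

Lemma power_complete : tvs_complete [set: power].
Proof. by apply: weak_complete => a; exists a. Qed.

(** Given a finite list S, choose a point of U close to x on S. A box around it
inside U involves finitely many coordinates T, so the point can be reset to x
outside S ++ T without leaving U. Repeating this with S ++ T in place of S gives
a sequence in U that tends to x: a coordinate that enters some list is
controlled from then on, and on every other coordinate all terms agree with x.
*)
Lemma power_kappa_frechet_urysohn : kappa_frechet_urysohn power.
Proof.
move=> U x Uo Ux.
pose step (p q : seq I * power * nat) := [/\ {subset p.1.1 <= q.1.1},
  q.2 = p.2.+1, U q.1.2,
  forall s, s \in p.1.1 -> `|q.1.2 s - x s| < p.2.+1%:R^-1 &
  forall s, s \notin q.1.1 -> q.1.2 s = x s].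
have next p : {q | step p q}.
  apply: cid; case: p => [[S y0] n].
  have e0 : 0 < n.+1%:R^-1 :> R by rewrite invr_gt0.
  have [y [Uy yx]] := Ux _ (nbhs_box S x e0).
  have [T [e [e_gt0 eU]]] : nbhs y U by exact: open_nbhs_nbhs.
  exists (S ++ T, (fun s => if s \in S ++ T then y s else x s), n.+1).
  rewrite /step /=; split=> //.
  - by move=> s sS; rewrite mem_cat sS.
  - by apply: eU => t tT; rewrite /= /eval mem_cat tT orbT subrr normr0.
  - by move=> s sS; rewrite mem_cat sS; exact: yx.
  - by move=> s /negbTE ->.
have [h [h0 hS]] := dependent_choice next ([::], x, 0%N).
have hn n : (h n).2 = n.
  by elim: n => [|n IH]; [rewrite h0|have [_ -> _ _ _] := hS n; rewrite IH].
have mono m n : (m <= n)%N -> {subset (h m).1.1 <= (h n).1.1}.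
  elim: n => [|n IH]; first by rewrite leqn0 => /eqP ->.
  rewrite leq_eqVlt => /predU1P[->//|/IH mn s /mn].
  by have [SS _ _ _ _] := hS n; exact: SS.
exists (fun n => (h n.+1).1.2); first by move=> n; have [] := hS n.
apply/cvg_weakP => t; rewrite /= /eval.
have [[N tN]|/forallNP tN] := pselect (exists N, t \in (h N).1.1); last first.
  apply: cvg_near_cst; exists 0%N => // n _ /=.
  by have [_ _ _ _] := hS n; apply; exact/negP.
apply/cvgrPdist_lt => e e_gt0.
have [K _ KP] := near_infty_natSinv_lt (PosNum e_gt0).
exists (maxn N K) => // n; rewrite /= geq_max => /andP[Nn Kn].
have [_ _ _ + _] := hS n; move=> /(_ t (mono _ _ Nn _ tN)).
by rewrite hn distrC => /lt_trans; apply; exact: KP.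
Qed.

End cartesian_power.

(** * Completion *)

Section completion.
Context (R : realType).
Local Notation tree := (tree R).
Local Notation E := (tree_space R).

Definition evaluation (x : E) : power R tree := fun t => probe t x.

Fact evaluation_is_linear : linear evaluation.
Proof. by move=> k x y; apply/funext => t; rewrite /evaluation linearP. Qed.

HB.instance Definition _ := GRing.isLinear.Build R E (power R tree) *:%R
  evaluation evaluation_is_linear.

(** Both topologies are given by boxes on the same functionals, whence the
initial topology; the range is dense since the values of finitely many
functionals can be prescribed. *)
Lemma evaluation_is_completion :
  is_completion (evaluation : {linear E -> power R tree}).
Proof.
split; [exact: power_hausdorff|exact: power_complete|..].
- move=> x y xy; apply/eqP; rewrite -subr_eq0; apply/eqP/probe_inj => t.
  rewrite linearB; apply/eqP; rewrite subr_eq0.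
  by apply/eqP/(congr1 (@^~ t) xy).
- move=> A; split=> [Ao|[B Bo <-]]; last first.
    rewrite openE => x Bx.
    have [S [e [e0 eB]]] : nbhs (evaluation x) B by exact: open_nbhs_nbhs.
    by exists S, e; split=> // y xy; apply: eB.
  (* The same boxes, taken in the power, give an open set that extends A. *)
  exists (\bigcup_(p in [set p : E * seq tree * R |
      0 < p.2 /\ box p.1.2 p.2 p.1.1 `<=` A])
    (box p.1.2 p.2 (evaluation p.1.1) : set (power R tree))).
    by apply: bigcup_open => p _; exact: open_box.
  apply/seteqP; split=> [y [[[x S] e] [/= e0 eA] yx]|x Ax]; first exact: eA.
  have [S [e [e0 eA]]] : nbhs x A by exact: open_nbhs_nbhs.
  by exists (x, S, e) => //; exact: box_center.
- move=> O [a Oa] Oo.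
  have [S [e [e0 eO]]] : nbhs a O by exact: open_nbhs_nbhs.
  have [x xE] := probe_prescribe (fun=> S) a.
  exists (evaluation x); split; last by exists x.
  by apply: eO => t tS; rewrite /= /eval /evaluation (xE 0%N)// subrr normr0.
Qed.

End completion.

(** * Failure of the kappa-Frechet-Urysohn property *)

Section steep.
Context (R : realType).
Local Notation tree := (tree R).
Local Notation E := (tree_space R).

(** The values of a vector supported in S at d + 1 functionals, with d = size S,
are combinations of the d columns of a matrix of pairings with d + 1 rows, which
has a nonzero vector in its left kernel. *)
Lemma exists_annihilator (S : seq tree) : exists2 c : nat -> R,
  (exists2 j, (j <= size S)%N & c j != 0) &
  forall x : E, supported_in S x ->
    \sum_(i < (size S).+1) c i * probe (trunk R i) x = 0.
Proof.
pose A := \matrix_(i < (size S).+1, j < size S)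
  pairing (nth (leaf R) S j) (trunk R i).
have : kermx A != 0.
  by rewrite -mxrank_eq0 mxrank_ker subn_eq0 -ltnNge ltnS rank_leq_col.
move=> /rowV0Pn[v /sub_kermxP vA v0].
exists (fun i => v 0 (inord i)).
  have /rV0Pn[j vj] := v0.
  by exists j; rewrite ?inord_val// -ltnS.
move=> x xS.
under eq_bigr do rewrite inord_val /probe /= (lincombE _ xS) mulr_sumr.
rewrite exchange_big /= big_seq big1// => s; rewrite mem_undup => sS.
have sj : (index s S < size S)%N by rewrite index_mem.
have /matrixP/(_ 0 (Ordinal sj)) := vA; rewrite !mxE => vA0.
transitivity (x s * \sum_i v 0 i * A i (Ordinal sj)); last first.
  by rewrite vA0 mulr0.
rewrite mulr_sumr; apply: eq_bigr => i _.
by rewrite mxE /= nth_index// mulrCA.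
Qed.

(** Vectors with |y_0| > tau and |y_(i+1)| < tau |y_i| for i < k, where
y_i = probe (trunk R i) and tau = 1 / (k + 1).  In particular y_i is nonzero for
i < k, and small values of y_0 force k to be large. *)
Definition steep k : set E := [set x | k.+1%:R^-1 < `|probe (trunk R 0) x| /\
  forall i, (i < k)%N ->
    `|probe (trunk R i.+1) x| < k.+1%:R^-1 * `|probe (trunk R i) x|].

Lemma open_steep k : open (steep k).
Proof.
have cn i : continuous (fun x : E => `|probe (trunk R i) x|).
  have pc : continuous (probe (trunk R i) : E -> R) by exact: form_continuous.
  by move=> x; exact: (cvg_norm (pc x)).
have og (f : E -> R) r : continuous f -> open [set x | r < f x].
  by move=> fc; apply: (@open_comp _ _ f [set y | r < y]) => [x _|];
    [exact: fc|exact: open_gt].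
suff oW m : open [set x : E | forall i, (i < m)%N ->
    `|probe (trunk R i.+1) x| < k.+1%:R^-1 * `|probe (trunk R i) x|].
  by apply: openI; [exact: og|exact: oW].
elim: m => [|m IH].
  by rewrite (_ : mkset _ = setT); [exact: openT|exact/seteqP].
rewrite (_ : mkset _ = [set x : E | forall i, (i < m)%N ->
    `|probe (trunk R i.+1) x| < k.+1%:R^-1 * `|probe (trunk R i) x|] `&`
  [set x : E | 0 <
    k.+1%:R^-1 * `|probe (trunk R m) x| - `|probe (trunk R m.+1) x|]).
  apply: openI; [exact: IH|apply: og => x].
  exact: (cvgB (cvgM (cvg_cst _) (cn m x)) (cn m.+1 x)).
apply/seteqP; split=> x /=.
  by move=> xm; rewrite subr_gt0; split=> [i im|]; apply: xm; rewrite // ltnW.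
rewrite subr_gt0 => -[xm xm'] i.
by rewrite ltnS leq_eqVlt => /predU1P[->//|/xm].
Qed.

(** Prescribing y_0 = 2 tau, and successive ratios tau / 2, gives a vector of
[steep k] whose values at all the functionals of a given finite list are at most
2 tau: the functionals outside the sequence y_i are given the value 0. *)
Lemma closure_steep : closure (\bigcup_k steep k) (0 : E).
Proof.
move=> A [S [e [e0 eA]]].
have [k ke] : exists k, 2 * k.+1%:R^-1 < e :> R.
  have e20 : 0 < e / 2 by rewrite divr_gt0.
  have [k _ kP] := near_infty_natSinv_lt (PosNum e20).
  by exists k; rewrite mulrC -ltr_pdivlMr//; exact: kP (leqnn k).
pose b i : R := 2 * k.+1%:R^-1 * (k.+1%:R^-1 / 2) ^+ i.
have k1 : k.+1%:R^-1 <= 1 :> R by rewrite invf_le1// ler1n.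
have k0 : 0 < k.+1%:R^-1 :> R by rewrite invr_gt0.
have b0 i : 0 < b i by rewrite !mulr_gt0// exprn_gt0// mulr_gt0.
have be i : b i < e.
  apply: le_lt_trans ke; apply: ler_piMr; first by rewrite ltW// mulr_gt0.
  by apply: exprn_ile1; [rewrite ltW// divr_gt0|
    rewrite ler_pdivrMr// mul1r (le_trans k1)// ler1n].
pose a t := xget 0 [set r | exists2 i, t = trunk R i & r = b i].
have aT i : a (trunk R i) = b i.
  rewrite /a; case: xgetP => [r _ [j /trunk_inj -> ->]//|/(_ (b i))[]].
  by exists i.
have ae t : `|a t| < e.
  rewrite /a; case: xgetP => [r _ [j _ ->]|_]; last by rewrite normr0.
  by rewrite gtr0_norm.
have [x xE] := probe_prescribe
  (fun N => if N is i.+1 then [:: trunk R i] else S) a.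
have xT i : probe (trunk R i) x = b i by rewrite (xE i.+1) ?mem_head.
exists x; split; last first.
  by apply: eA => t tS; rewrite linear0 subr0 (xE 0%N)//.
exists k => //; split=> [|i _]; rewrite !xT !gtr0_norm//.
  by rewrite /b expr0 mulr1 ltr_pMl// ltr1n.
rewrite /b exprS [ltLHS]mulrCA ltr_pM2r; last exact: b0.
by rewrite ltr_pdivrMr// ltr_pMr// ltr1n.
Qed.

(** Let c_0 y_0 + ... + c_d y_d = 0 along a null sequence in the union of the
[steep k], with c_j the first nonzero coefficient. For k > d the ratios give
|y_i| <= tau |y_j| when j < i <= d, hence |c_j| |y_j| <= C tau |y_j| with C the
sum of the |c_i|. Since y_j is nonzero, |c_j| <= C tau, which is false once tau
is small, and tau < |y_0| tends to 0. *)
Lemma tree_space_not_kappa_frechet_urysohn : ~ kappa_frechet_urysohn E.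
Proof.
have Wo : open (\bigcup_k steep k).
  by apply: bigcup_open => k _; exact: open_steep.
move=> /(_ _ _ Wo closure_steep)[u uW u0].
have [S uS] := null_sequence_supported u0.
have [c [j0 j0S cj0] cP] := exists_annihilator S.
have exc : exists j, c j != 0 by exists j0.
case: (ex_minnP exc) => j cj jmin.
have jS : (j <= size S)%N by exact: leq_trans (jmin _ cj0) j0S.
pose C := \sum_(i < (size S).+1) `|c i|.
have C0 : 0 <= C by apply: sumr_ge0.
pose e := Num.min (size S).+1%:R^-1 (`|c j| / (C + 1)).
have e0 : 0 < e.
  by rewrite lt_min invr_gt0 ltr0n/= divr_gt0 ?normr_gt0// ltr_wpDl.
have [n _ /(_ n (leqnn n)) nP] := u0 _ (nbhs_box [:: trunk R 0] (0 : E) e0).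
have := nP (trunk R 0); rewrite mem_head linear0 subr0 => /(_ isT).
have [k _ [ky yk]] := uW n.
pose y i := probe (trunk R i) (u n); rewrite -!/(y _) in ky yk * => y0e.
pose t : R := k.+1%:R^-1; rewrite -!/t in ky yk.
have t0 : 0 < t by rewrite invr_gt0.
have t1 : t <= 1 by rewrite invf_le1// ler1n.
have := lt_trans ky y0e; rewrite lt_min => /andP[tS tc].
have Sk : (size S < k)%N.
  by move: tS; rewrite /t ltf_pV2 ?posrE// ltr_nat ltnS.
have yj0 : 0 < `|y j|.
  have /(le_lt_trans (normr_ge0 _)) := yk j (leq_ltn_trans jS Sk).
  by rewrite pmulr_rgt0.
have yle i : (j < i)%N -> (i <= size S)%N -> `|y i| <= t * `|y j|.
  elim: i => // i IH; rewrite ltnS leq_eqVlt => /predU1P[<-|ji] iS.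
    by rewrite ltW// yk// (leq_trans iS (ltnW Sk)).
  apply: le_trans (IH ji (ltnW iS)).
  rewrite (le_trans (ltW (yk i (leq_trans iS (ltnW Sk)))))//.
  by rewrite ler_piMl.
have := cP (u n) (uS n).
have jS' : (j < (size S).+1)%N by [].
rewrite (bigD1 (Ordinal jS')) //= => /eqP; rewrite addr_eq0 => /eqP cy.
have : `|c j| * `|y j| <= C * t * `|y j|.
  rewrite -normrM cy normrN (le_trans (ler_norm_sum _ _ _))//.
  rewrite /C -mulrA mulr_suml [leRHS](bigD1 (Ordinal jS'))//=.
  apply: ler_wpDl; first by rewrite mulr_ge0// mulr_ge0// ltW.
  apply: ler_sum => i ij; rewrite normrM.
  have [ci|ci] := eqVneq (c i) 0; first by rewrite ci normr0 !mul0r.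
  rewrite ler_wpM2l// yle//; last by rewrite -ltnS.
  rewrite ltn_neqAle jmin// andbT; apply: contra ij => /eqP ji.
  by apply/eqP/val_inj.
rewrite ler_pM2r// leNgt => /negP; apply.
move: tc; rewrite ltr_pdivlMr ?ltr_wpDl//; apply: le_lt_trans.
by rewrite mulrDr mulr1 mulrC lerDl ltW.
Qed.

End steep.

(** * The theorem *)

Theorem mainTheorem11 (R : realType) :
  exists E : tvsType R,
    [/\ hausdorff_space E,
        baire_space E,
        [/\ feral E, quasi_complete E & property_K E],
        ~ kappa_frechet_urysohn E &
        exists (F : tvsType R) (i : {linear E -> F}),
          is_completion i /\ kappa_frechet_urysohn F].
Proof.
exists (tree_space R); split.
- exact: tree_space_hausdorff.
- exact: tree_space_baire.
- split; [exact: tree_space_feral|exact: tree_space_quasi_complete|].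
  exact: tree_space_property_K.
- exact: tree_space_not_kappa_frechet_urysohn.
- exists (power R (tree R)), (@evaluation R); split.
    exact: evaluation_is_completion.
  exact: power_kappa_frechet_urysohn.
Qed.
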